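(* Let $s_0,s_f,v_0,v_f\in\mathbb{R}$ be arbitrary. Let $u_{\mathrm{e}}$ be the minimum-energy control, i.e. the minimizer of $\frac12\int_0^1u(t)^2\,dt$ subject to $\dot x_1(t)=x_2(t)$, $\dot x_2(t)=u(t)$ on $[0,1]$, $x_1(0)=s_0$, $x_1(1)=s_f$, $x_2(0)=v_0$, $x_2(1)=v_f$. For each $\alpha>0$ let $u_\alpha$ be the minimizer, over $u\in W^{1,1}([0,1];\mathbb{R})$ satisfying the same constraints, of $\frac12\int_0^1u(t)^2\,dt+\alpha\,\mathrm{TV}(u)$, and let $u_\infty$ be the asymptotic optimal control, i.e. the limit of $u_\alpha(t)$ as $\alpha\to\infty$ for $t\in[0,1]\setminus\{1/2\}$, with its value at $t=1/2$ taken to be its constant value on $(1/2,1]$. Then $$\mathrm{TV}(u_{\mathrm{e}})=6\,\big|2(s_f-s_0)-v_f-v_0\big|$$ and the asymptotic minimum total variation is exactly $2/3$ of the total variation of the minimum-energy control: $$\mathrm{TV}(u_\infty)=\frac23\,\mathrm{TV}(u_{\mathrm{e}}).$$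
   Context: For $u:[0,1]\to\mathbb{R}$ (not necessarily continuous), the total variation is $\mathrm{TV}(u)=\sup\sum_{i=1}^N|u(\tau_i)-u(\tau_{i-1})|$, the supremum being over all partitions $0=\tau_0<\tau_1<\dots<\tau_N=1$; for absolutely continuous $u$ it equals $\int_0^1|\dot u(t)|\,dt$. The states $x_1,x_2$ are absolutely continuous. The minimum-energy control is taken in its continuous representative. *)

(* Defs.v *)
From HB Require Import structures.
From mathcomp Require Import all_boot all_order all_algebra.
From mathcomp Require Import all_classical all_reals all_analysis.
Import Order.TTheory GRing.Theory Num.Theory.
Import numFieldNormedType.Exports.

Set Implicit Arguments.
Unset Strict Implicit.
Unset Printing Implicit Defensive.

Local Open Scope classical_set_scope.
Local Open Scope ring_scope.

Definition abs_continuous (R : realType) (a b : R) (f : R -> R) : Prop :=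
  forall e : R, 0 < e -> exists2 d : R, 0 < d &
    forall (n : nat) (l r : 'I_n -> R),
      (forall i, [/\ a <= l i, l i <= r i & r i <= b]) ->
      trivIset [set: 'I_n] (fun i => `]l i, r i[%classic : set R) ->
      \sum_(i < n) (r i - l i) < d ->
      \sum_(i < n) `|f (r i) - f (l i)| < e.

(* W^{1,1}([0,1]) is identified with the absolutely continuous functions on
   [0,1], every class being represented by its continuous representative. *)
Definition W11 (R : realType) (u : R -> R) : Prop := abs_continuous 0 1 u.

(* Functions on [0,1] are total functions R -> R of which only the values on
   [0,1] matter: the differential equations are required almost everywhere,
   hence only at interior points. *)
Definition steers (R : realType) (s0 sf v0 vf : R) (u : R -> R) : Prop :=
  exists x1 x2 : R -> R,
    [/\ abs_continuous 0 1 x1 /\ abs_continuous 0 1 x2,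
        {ae @lebesgue_measure R, forall t : R, `[0%R, 1%R]%classic t ->
           is_derive t (1 : R) x1 (x2 t)},
        {ae @lebesgue_measure R, forall t : R, `[0%R, 1%R]%classic t ->
           is_derive t (1 : R) x2 (u t)},
        x1 0 = s0 /\ x1 1 = sf &
        x2 0 = v0 /\ x2 1 = vf].

Definition square_integrable (R : realType) (u : R -> R) : Prop :=
  measurable_fun (`[0%R, 1%R]%classic : set R) u /\
  (@lebesgue_measure R).-integrable `[0%R, 1%R]%classic
     (fun t => (u t ^+ 2)%:E).

Definition energy (R : realType) (u : R -> R) : \bar R :=
  (2^-1%:E * \int[@lebesgue_measure R]_(t in `[0%R, 1%R]) (u t ^+ 2)%:E)%E.

Definition TV01 (R : realType) (u : R -> R) : \bar R :=
  total_variation 0 1 u.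

(* The minimum is over L^2 controls; the continuity clause selects the
   continuous representative of the minimizer. *)
Definition min_energy_control (R : realType) (s0 sf v0 vf : R)
    (u : R -> R) : Prop :=
  [/\ square_integrable u, steers s0 sf v0 vf u,
      {within `[0%R, 1%R], continuous u} &
      forall v : R -> R, square_integrable v -> steers s0 sf v0 vf v ->
        (energy u <= energy v)%E].

Definition tv_cost (R : realType) (alpha : R) (u : R -> R) : \bar R :=
  (energy u + alpha%:E * TV01 u)%E.

Definition min_tv_control (R : realType) (s0 sf v0 vf alpha : R)
    (u : R -> R) : Prop :=
  [/\ W11 u, steers s0 sf v0 vf u &
      forall v : R -> R, W11 v -> steers s0 sf v0 vf v ->
        (tv_cost alpha u <= tv_cost alpha v)%E].

Definition min_tv_family (R : realType) (s0 sf v0 vf : R)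
    (ua : R -> R -> R) : Prop :=
  forall alpha : R, 0 < alpha -> min_tv_control s0 sf v0 vf alpha (ua alpha).

(* The pointwise limit leaves the value at 1/2 free; the last clause fixes it
   as the constant value of the limit on (1/2,1]. *)
Definition asymptotic_control (R : realType) (ua : R -> R -> R)
    (uinf : R -> R) : Prop :=
  (forall t : R, 0 <= t <= 1 -> t != 2^-1 ->
     ua alpha t @[alpha --> +oo] --> uinf t) /\
  (forall t : R, 2^-1 < t <= 1 -> uinf t = uinf 2^-1).

(* Main.v *)
Require Import Defs.
From HB Require Import structures.
From mathcomp Require Import all_boot all_order all_algebra.
From mathcomp Require Import all_classical all_reals all_analysis.
From mathcomp Require Import measurable_realfun ring lra.
Import Order.TTheory GRing.Theory Num.Theory.
Import numFieldNormedType.Exports.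

Local Open Scope classical_set_scope.
Local Open Scope ring_scope.

(* Write A = vf - v0 and D = 2 (sf - s0) - vf - v0. The boundary conditions on
   u amount to the two moment conditions int u = A and int (1 - 2 t) u = D.
   The optimal controls all have the form u = A + c clamp(t - 1/2), clamped to
   [-b, b]: they steer iff c (b/2 - 2 b^3/3) = -D, and such a u minimizes
   energy + alpha TV as soon as alpha = |c| (1/2 - b)^2 / 2. Indeed, with l the
   affine function A + c (t - 1/2) and v admissible, int u (v - u) equals
   int (u - l) (v - u), where u - l = c ((a - t)^+ - (t - 1 + a)^+), a = 1/2 - b,
   lives near the two ends of [0, 1]; this integral is at least
   - alpha (TV v - TV u) because the oscillation of v is at most TV v.
   The square of v - u left over in the energy gives uniqueness.
   For b = 1/2 and alpha = 0 this is the minimum-energy control, c = -6 D. As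
   alpha goes to infinity, b goes to 0 and c b to -2 D, so u_alpha tends to the
   step function with values A + 2 D and A - 2 D. *)

(** * Disjoint intervals, and functions whose derivative vanishes almost everywhere *)

Lemma trivIset_ordered_intervals (R : realType) (n : nat) (l r : nat -> R) :
  (forall i j, (i < j < n)%N -> r i <= l j) ->
  trivIset [set: 'I_n] (fun i : 'I_n => `]l i, r i[%classic : set R).
Proof.
move=> rl; apply/trivIsetP => i j _ _ ij; apply/seteqP; split => // x [] /=.
rewrite !in_itv/= => /andP[xi ix] /andP[xj jx].
have [ltij|ltji|/val_inj eqij] := ltngtP i j; last by rewrite eqij eqxx in ij.
- by have := rl i j; rewrite ltij ltn_ord => /(_ isT); lra.
- by have := rl j i; rewrite ltji ltn_ord => /(_ isT); lra.
Qed.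

Lemma measure_bigcup_intervals (R : realType) (n : nat) (l r : 'I_n -> R) :
  (forall i, l i <= r i) ->
  trivIset [set: 'I_n] (fun i => `]l i, r i[%classic : set R) ->
  @lebesgue_measure R (\big[setU/set0]_(i < n) `]l i, r i[%classic) =
  (\sum_(i < n) (r i - l i))%:E.
Proof.
move=> lr tr.
transitivity (\int[@lebesgue_measure R]_(x in \big[setU/set0]_(i < n) `]l i, r i[%classic) cst 1%E x)%E.
  rewrite integral_cst ?mul1e//; apply: bigsetU_measurable => i _.
  exact: measurable_itv.
rewrite ge0_integral_bigsetU//=.
- rewrite -sumEFin; apply: eq_bigr => i _.
  rewrite integral_cst ?mul1e; last exact: measurable_itv.
  rewrite [LHS](@lebesgue_measure_itv R `]l i, r i[)/= lte_fin; case: ltP => // rl.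
  by rewrite (@le_anti _ _ (l i) (r i)) ?subrr// lr rl.
- exact: index_enum_uniq.
- by rewrite (_ : [set` index_enum _] = setT)//; apply/seteqP; split => // i _ /=; rewrite mem_index_enum.
Qed.

Lemma sum_intervals_le_measure (R : realType) (n : nat) (l r : 'I_n -> R)
    (U : set R) : measurable U ->
  (forall i, l i <= r i /\ `]l i, r i[%classic `<=` U) ->
  trivIset [set: 'I_n] (fun i => `]l i, r i[%classic : set R) ->
  ((\sum_(i < n) (r i - l i))%:E <= @lebesgue_measure R U)%E.
Proof.
move=> mU lr tr; rewrite -measure_bigcup_intervals//; last first.
  by move=> i; case: (lr i).
apply: le_measure; rewrite ?inE//.
  by apply: bigsetU_measurable => i _; exact: measurable_itv.
by elim/big_ind : _ => [||i _]; [exact: sub0set|move=> A B ? ?; rewrite subUset|case: (lr i)].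
Qed.

(** Multiplying the difference quotient by [y - x] removes the division and the exception [y = x],
    so that Taylor-type bounds give derivatives directly. *)
Lemma is_derive1P (R : realType) (f : R -> R) (x df : R) :
  is_derive x (1 : R) f df <->
  forall e, 0 < e -> exists2 g, 0 < g &
    forall y, `|y - x| < g -> `|f y - f x - df * (y - x)| <= e * `|y - x|.
Proof.
split=> [fx e e0|fx].
  have [cf <-] := fx.
  have /cvgrPdist_le/(_ e e0)[g /= g0 gf] : h^-1 *: (f (h *: 1 + x) - f x) @[h --> (0 : R)^'] --> 'D_1 f x.
    exact: cf.
  exists g => // y yx; have [->|yx0] := eqVneq y x; first by rewrite !subrr mulr0 subrr normr0 mulr0.
  have h0 : y - x != 0 by rewrite subr_eq0.
  have := gf (y - x).
  rewrite /= sub0r normrN => /(_ yx h0).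
  rewrite /GRing.scale/= mulr1 subrK distrC => le.
  rewrite -ler_pdivrMr ?normr_gt0// -normf_div mulrBl mulfK//.
  by rewrite mulrC.
have cf : h^-1 *: ((f \o shift x) (h *: 1) - f x) @[h --> (0 : R)^'] --> df.
  apply/cvgrPdist_le => e e0; have [g g0 gf] := fx e e0.
  exists g => //= h /=; rewrite sub0r normrN => hg h0.
  have := gf (h + x); rewrite addrK => /(_ hg).
  rewrite /GRing.scale/= mulr1 distrC => le.
  rewrite -(ler_pM2r (x := `|h|)) ?normr_gt0// -normrM mulrBl mulrAC mulVf// mul1r.
  done.
by split; [apply/cvg_ex; exists df|exact: cvg_lim].
Qed.

(* Continuous induction on t: f t - f 0 is controlled by e * t plus the
   variation of f over finitely many disjoint intervals inside an open set U
   covering the points where f' = 0 fails. *)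
Lemma abs_continuous_ae_derive0 (R : realType) (f : R -> R) :
  abs_continuous 0 1 f ->
  {ae @lebesgue_measure R, forall t : R, `[0%R, 1%R]%classic t ->
     is_derive t (1 : R) f 0} ->
  f 1 = f 0.
Proof.
move=> acf [N [mN N0 subN]].
(* One [e] pays for the points where the derivative is 0, the other for the intervals inside [U],
   whose total length is below the modulus [d] of absolute continuity. *)
suff H (e : R) : 0 < e -> `|f 1 - f 0| <= e + e.
  apply/eqP; rewrite -subr_eq0 -normr_le0; apply/ler_addgt0Pl => e e0.
  by rewrite addr0 (splitr e); apply: H; rewrite divr_gt0.
move=> e0; have [d d0 Hd] := acf e e0.
have [U [oU NU Ud]] : exists U : set R, [/\ open U, N `<=` U & (@lebesgue_measure R U < d%:E)%E].
  have N0' : @lebesgue_measure R N = 0%E := N0.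
  have [|U [oU NU UN]] := @lebesgue_regularity_outer R N d mN _ d0.
    by apply: le_lt_trans (ltry 0); rewrite le_eqVlt; apply/orP; left; apply/eqP; exact: N0'.
  exists U; split => //; apply: le_lt_trans UN.
  have mU : measurable U by exact: measurable_realfun.open_measurable.
  rewrite -{1}(setDUK NU) (le_trans (measureU2 _ _ _))//; first exact: measurableD.
  have : (@lebesgue_measure R N + @lebesgue_measure R (U `\` N) <= @lebesgue_measure R (U `\` N))%E.
    by rewrite (_ : lebesgue_measure N = 0%E)// add0e.
  exact.
have mU : measurable U by exact: measurable_realfun.open_measurable. move: {N0}Ud => Ud.
(* The endpoints are total sequences read below [n], so appending an interval only overwrites index
   [n]. *)
pose fam t (n : nat) (l r : nat -> R) :=
  [/\ forall i, (i < n)%N -> [/\ 0 <= l i, l i <= r i, r i <= t & `]l i, r i[%classic `<=` U],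
      forall i j, (i < j < n)%N -> r i <= l j &
      `|f t - f 0| <= e * t + \sum_(i < n) `|f (r i) - f (l i)|].
pose S := [set t | 0 <= t <= 1 /\ exists n l r, fam t n l r].
have S0 : S 0.
  split; first lra.
  exists 0%N, (fun=> 0), (fun=> 0); split => //.
  by rewrite big_ord0 subrr normr0; lra.
suff [_ [n [l [r [lrU rl fS]]]]] : S 1.
  apply: (le_trans fS); rewrite mulr1 lerD2l; apply: ltW.
  apply: Hd.
  - by move=> i; have [] := lrU i (ltn_ord i).
  - exact: trivIset_ordered_intervals.
  - rewrite -lte_fin; apply: le_lt_trans Ud.
    apply: sum_intervals_le_measure => //.
    + by move=> i; have [] := lrU i (ltn_ord i).
    + exact: trivIset_ordered_intervals.
have hS : has_sup S by split; [exists 0|exists 1 => x [/andP[]]].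
pose s := sup S.
have s0 : 0 <= s by exact: sup_upper_bound.
have s1 : s <= 1 by apply: ge_sup => [|x [/andP[]]//]; exists 0.
(* A point of [S] in (s - g, s] is carried by [step] either to 1, as wanted, or to [s + g / 2],
   which contradicts the choice of [s] as supremum. *)
suff [g g0 step] : exists2 g : R, 0 < g & forall t t', s - g < t <= s -> s <= t' <= s + g / 2 ->
    t' <= 1 -> S t -> S t'.
  have [t St st] := sup_adherent g0 hS.
  have ts : t <= s by exact: sup_upper_bound.
  have [le1|gt1] := leP 1 (s + g / 2).
    by apply: (step t) => //; rewrite ?st ?ts// s1 le1.
  have : S (s + g / 2) by apply: (step t) => //; rewrite ?st ?ts//; lra.
  by move=> /(sup_upper_bound hS); rewrite -/s; lra.
(* If [s] is exceptional, the interval from [t] to [t'] lies in a ball contained in [U] and joins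
   the family. *)
have [Ns|nNs] := pselect (N s).
  have [g /= g0 gU] : exists2 g : R, 0 < g & ball s g `<=` U by apply/nbhs_ballP; apply: open_nbhs_nbhs; split => //; exact: NU.
  exists g => // t t' /andP[gt ts] /andP[st' t'g] t'1 [/andP[t0 t1] [n [l [r [lrU rl fS]]]]].
  split; first by apply/andP; split; lra.
  exists n.+1, (fun i => if i == n then t else l i), (fun i => if i == n then t' else r i); split.
  - move=> i; rewrite ltnS leq_eqVlt; case: eqP => [_ _|/= _ /lrU[? ? ? ?]]; last by split => //; lra.
    split => //; try lra.
    move=> x; rewrite /= in_itv/= => /andP[tx xt']; apply: gU.
    by apply: ball_sym; rewrite /ball/= ltr_norml; lra.
  - move=> i j /andP[ij]; rewrite ltnS leq_eqVlt; case: (eqVneq j n) => [jn _|/= _ jn].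
      by rewrite ltn_eqF -?jn//; have [|//] := lrU i; rewrite -jn.
    by rewrite ltn_eqF ?(ltn_trans ij)// rl// ij.
  - rewrite big_ord_recr/= eqxx.
    rewrite (eq_bigr (fun i : 'I_n => `|f (r i) - f (l i)|)); last first.
      by move=> i _; rewrite ltn_eqF.
    have := ler_distD (f t) (f t') (f 0).
    have : e * t <= e * t' by rewrite ler_pM2l//; lra.
    by lra.
(* Otherwise the derivative at [s] is 0: the family stays the same, and the increments from [t] to
   [s] and from [s] to [t'] are absorbed by the term [e * t']. *)
have /= fs : is_derive s (1 : R) f 0.
  apply: contrapT => nd; apply: nNs; apply: subN => /=; apply: contra_not nd.
  by apply; rewrite in_itv/= s0 s1.
have [g g0 gf] : exists2 g : R, 0 < g & forall x, `|x - s| < g -> `|f x - f s| <= e * `|x - s|.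
  have [g g0 gf] := (is_derive1P R f s 0).1 fs e e0.
  by exists g => // x /gf; rewrite mul0r subr0.
exists g => // t t' /andP[gt ts] /andP[st' t'g] t'1 [/andP[t0 t1] [n [l [r [lrU rl fS]]]]].
split; first by apply/andP; split; lra.
exists n, l, r; split => //.
  by move=> i /lrU[? ? ? ?]; split => //; lra.
have ft : `|f s - f t| <= e * (s - t).
  have := gf t; rewrite (distrC t) (ger0_norm (x := s - t)) ?subr_ge0//.
  by rewrite (distrC (f t)); apply; lra.
have ft' : `|f t' - f s| <= e * (t' - s).
  have := gf t'; rewrite (ger0_norm (x := t' - s)) ?subr_ge0//.
  by apply; lra.
have := ler_distD (f t) (f t') (f 0); have := ler_distD (f s) (f t') (f t).
by lra.
Qed.

(** * Absolutely continuous functions and the fundamental theorem of calculus *)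

Lemma abs_continuousB (R : realType) (a b : R) (f g : R -> R) :
  abs_continuous a b f -> abs_continuous a b g ->
  abs_continuous a b (fun t => f t - g t).
Proof.
move=> acf acg e e0.
have [d d0 Hd] := acf _ (divr_gt0 e0 (ltr0Sn R 1)).
have [d' d'0 Hd'] := acg _ (divr_gt0 e0 (ltr0Sn R 1)).
exists (Num.min d d') => [|n l r lr tr]; first by rewrite lt_min d0.
rewrite lt_min => /andP[sd sd'].
rewrite (splitr e); apply: le_lt_trans (ltrD (Hd n l r lr tr sd) (Hd' n l r lr tr sd')).
rewrite -big_split/=; apply: ler_sum => i _.
rewrite (_ : _ - _ = f (r i) - f (l i) - (g (r i) - g (l i))); last by ring.
exact: ler_normB.
Qed.

Lemma abs_continuous_lipschitz (R : realType) (a b k : R) (f : R -> R) :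
  (forall x y, a <= x -> x <= y -> y <= b -> `|f y - f x| <= k * (y - x)) ->
  abs_continuous a b f.
Proof.
(* Since [k] may be zero or negative, [|k| + 1] serves as a positive Lipschitz constant. *)
move=> fk e e0; have k0 : 0 < `|k| + 1 by rewrite ltr_wpDl.
exists (e / (`|k| + 1)) => [|n l r lr _ sd]; first exact: divr_gt0.
apply: le_lt_trans (_ : (`|k| + 1) * \sum_(i < n) (r i - l i) < _); last first.
  by rewrite mulrC -ltr_pdivlMr.
rewrite mulr_sumr; apply: ler_sum => i _; have [al lri rb] := lr i.
apply: (le_trans (fk _ _ al lri rb)); apply: ler_wpM2r; first by rewrite subr_ge0.
by rewrite (le_trans (ler_norm k))// lerDl.
Qed.

Lemma abs_continuous_within (R : realType) (a b : R) (f : R -> R) :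
  abs_continuous a b f -> {within `[a, b], continuous f}.
Proof.
move=> acf; apply/subspace_continuousP => x /=; rewrite in_itv/= => /andP[ax xb].
apply/cvgrPdist_lt => e e0; have [d d0 Hd] := acf e e0.
rewrite near_withinE; exists d => //= y xy; rewrite in_itv/= => /andP[ay yb].
have := Hd 1%N (fun=> Num.min x y) (fun=> Num.max x y).
rewrite !big_ord1 => H.
have {}H : `|f (Num.max x y) - f (Num.min x y)| < e.
  apply: H.
  - move=> _; rewrite le_min ge_max ax ay xb yb; split => //.
    by rewrite ge_min !le_max lexx.
  - by apply/trivIsetP => i j _ _; rewrite !ord1 eqxx.
  - by move: xy => /=; case: (leP x y) => xy; [rewrite distrC ger0_norm ?subr_ge0|rewrite gtr0_norm ?subr_gt0].
by move: H; case: (leP x y) => _ //; rewrite distrC.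
Qed.

Lemma within_continuous_bounded (R : realType) (a b : R) (f : R -> R) :
  {within `[a, b], continuous f} ->
  exists2 M, 0 < M & forall x, a <= x <= b -> `|f x| <= M.
Proof.
move=> cf; have := continuous_compact cf (@segment_compact R a b).
move=> /compact_bounded[M [_ fM]]; exists (`|M| + 1); first by rewrite ltr_wpDl.
move=> x axb; apply: (fM (`|M| + 1)); last by exists x.
by rewrite (le_lt_trans (ler_norm M))// ltrDl.
Qed.

Lemma abs_continuousM (R : realType) (a b : R) (f g : R -> R) :
  abs_continuous a b f -> abs_continuous a b g ->
  abs_continuous a b (fun t => f t * g t).
Proof.
move=> acf acg e e0.
have [M M0 fM] := within_continuous_bounded _ _ _ _ (abs_continuous_within _ _ _ _ acf).
have [K K0 gK] := within_continuous_bounded _ _ _ _ (abs_continuous_within _ _ _ _ acg).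
have e20 : 0 < e / 2 by exact: divr_gt0.
have [d d0 Hd] := acf _ (divr_gt0 e20 K0).
have [d' d'0 Hd'] := acg _ (divr_gt0 e20 M0).
exists (Num.min d d') => [|n l r lr tr]; first by rewrite lt_min d0.
rewrite lt_min => /andP[sd sd'].
rewrite (splitr e).
have := ltrD (Hd n l r lr tr sd) (Hd' n l r lr tr sd').
have {}Hd := Hd n l r lr tr sd; have {}Hd' := Hd' n l r lr tr sd'.
move=> _; rewrite ltr_pdivlMr// in Hd; rewrite ltr_pdivlMr// in Hd'.
apply: le_lt_trans (ltrD Hd Hd').
rewrite !mulr_suml -big_split/=; apply: ler_sum => i _; have [al lri rb] := lr i.
rewrite (_ : _ - _ = (f (r i) - f (l i)) * g (r i) + (g (r i) - g (l i)) * f (l i)); last by ring.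
apply: le_trans (ler_normD _ _) _; rewrite !normrM; apply: lerD; apply: ler_wpM2l => //.
  by apply: gK; rewrite rb (le_trans al).
by apply: fM; rewrite al (le_trans lri).
Qed.

Lemma abs_continuous_C1 (R : realType) (a b : R) (f g : R -> R) :
  (forall x, is_derive x (1 : R) f (g x)) -> {within `[a, b], continuous g} ->
  abs_continuous a b f.
Proof.
move=> fg cg; have [M M0 gM] := within_continuous_bounded _ _ _ _ cg.
apply: (abs_continuous_lipschitz _ _ _ M) => x y ax xy yb.
have [c] : exists2 c, c \in `[x, y] & f y - f x = g c * (y - x).
  apply: (MVT_segment xy).
  apply: continuous_subspaceT => z.
  by apply/differentiable_continuous/derivable1_diffP; have [] := fg z.
rewrite in_itv/= => /andP[xc cy] ->.
rewrite normrM (ger0_norm (x := y - x)) ?subr_ge0//.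
by rewrite ler_wpM2r ?subr_ge0// gM// (le_trans ax xc) (le_trans cy yb).
Qed.

(** The integral of |g| over the union of the intervals dominates the sum of the increments, and it
    is small when the measure of that union is. *)
Lemma abs_continuous_primitive (R : realType) (g : R -> R) :
  (@lebesgue_measure R).-integrable [set: R] (EFin \o g) ->
  abs_continuous 0 1 (fun y => \int[@lebesgue_measure R]_(t in `]-oo, y]) g t).
Proof.
move=> ig e e0; have [d [d0 Hd]] := integral_normr_continuous ig e0.
exists d => // n l r lr tr sd.
have mI i : measurable (`]l i, r i[%classic : set R) by exact: measurable_itv.
pose D := \big[setU/set0]_(i < n) (`]l i, r i[%classic : set R).
have mD : measurable D by apply: bigsetU_measurable => i _; exact: mI.
have /= := Hd D mD.
rewrite measure_bigcup_intervals// => [|i]; last by case: (lr i).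
rewrite lte_fin => /(_ sd); apply: le_lt_trans.
have iS A : measurable A -> (@lebesgue_measure R).-integrable A (EFin \o g).
  by move=> mA; apply: integrableS ig.
have ing A : measurable A -> (@lebesgue_measure R).-integrable A (EFin \o (fun x => `|g x|)).
  move=> mA; apply: integrableS (integrable_norm ig) => //.
apply: (@le_trans _ _ (\sum_(i < n) \int[@lebesgue_measure R]_(x in `]l i, r i[) `|g x|)).
  apply: ler_sum => i _; have [_ lri _] := lr i.
  rewrite Rintegral_itvB//; last by apply: iS.
  apply: le_trans (le_normr_Rintegral _ _) _ => //.
    by apply: iS.
  by rewrite Rintegral_itv_bndo_bndc//; exact: ing.
rewrite le_eqVlt; apply/orP; left; apply/eqP; apply: EFin_inj; rewrite -sumEFin /Rintegral fineK; last exact: integrable_fin_num (ing _ mD).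
rewrite ge0_integral_bigsetU//=.
- by apply: eq_bigr => i _; rewrite fineK//; exact: integrable_fin_num (ing _ (mI i)).
- exact: index_enum_uniq.
- by rewrite (_ : [set` index_enum _] = setT)//; apply/seteqP; split => // i _ /=; rewrite mem_index_enum.
- exact: measurable_int (ing _ mD).
Qed.

(** By Lebesgue differentiation the primitive [F] of [g], extended by 0 outside [0, 1], has
    derivative [g] almost everywhere on [0, 1]; then f - F has derivative 0 almost everywhere and
    takes the same value at 0 and 1. *)
Lemma abs_continuous_FTC (R : realType) (f g : R -> R) :
  abs_continuous 0 1 f ->
  {ae @lebesgue_measure R, forall t : R, `[0%R, 1%R]%classic t ->
     is_derive t (1 : R) f (g t)} ->
  (@lebesgue_measure R).-integrable `[0, 1] (EFin \o g) ->
  \int[@lebesgue_measure R]_(t in `[0, 1]) g t = f 1 - f 0.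
Proof.
move=> acf fg ig; pose G := g \_ `[0, 1].
have iG : (@lebesgue_measure R).-integrable [set: R] (EFin \o G).
  by have := ig; rewrite integrable_mkcond//= restrict_EFin.
pose F y := \int[@lebesgue_measure R]_(t in `]-oo, y]) G t.
have iS A : measurable A -> (@lebesgue_measure R).-integrable A (EFin \o G).
  by move=> mA; apply: integrableS iG.
have acF : abs_continuous 0 1 F := abs_continuous_primitive _ _ iG.
have F' : {ae @lebesgue_measure R, forall x, derivable F x 1 /\ derive1 F x = G x}.
  apply: FTC1Ny; first by move=> y; apply: integrableS iG.
  exact: open_integrable_locally openT iG.
have H := abs_continuous_ae_derive0 _ _ (abs_continuousB _ _ _ _ _ acf acF).
rewrite (_ : \int[_]_(t in _) _ = F 1 - F 0); last first.
  rewrite Rintegral_itvB ?bnd_simp ?ler01//; last by apply: iS.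
  rewrite Rintegral_itv_obnd_cbnd; last by apply: iS.
  by apply: eq_Rintegral => x x01; rewrite /G patchE x01.
suff : f 1 - F 1 = f 0 - F 0 by lra.
apply: H.
have ff := ae_filter_ringOfSetsType (@lebesgue_measure R).
apply: filterS2 fg F' => t fg [dF F'] t01.
rewrite -(subrr (g t)); apply: is_deriveB; first exact: fg.
apply: DeriveDef => //; rewrite -derive1E F' /G patchE mem_set//.
Qed.

(** * Ramps and the clamped affine controls *)

(** Powers of ramps satisfy such a quadratic bound on both sides of the kink as well as across it,
    so they are differentiated without separating these cases. *)
Lemma is_derive1_quadratic (R : realType) (f : R -> R) (x df k : R) : 0 <= k ->
  (forall y, `|y - x| < 1 -> `|f y - f x - df * (y - x)| <= k * (y - x) ^+ 2) ->
  is_derive x (1 : R) f df.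
Proof.
move=> k0 fk; apply/is_derive1P => e e0; have k1 : 0 < k + 1 by lra.
exists (Num.min 1 (e / (k + 1))) => [|y]; first by rewrite lt_min ltr01 divr_gt0.
rewrite lt_min ltr_pdivlMr// => /andP[y1 ye]; apply: le_trans (fk y y1) _.
rewrite -real_normK ?num_real// expr2 mulrA ler_wpM2r//.
by have := normr_ge0 (y - x); nra.
Qed.

Definition ramp (R : realType) (x : R) : R := Num.max x 0.

Lemma ramp_ge0 (R : realType) (x : R) : 0 <= ramp R x.
Proof. by rewrite /ramp le_max lexx orbT. Qed.

Lemma ramp_id (R : realType) (x : R) : 0 <= x -> ramp R x = x.
Proof. by move=> x0; rewrite /ramp; apply/max_idPl. Qed.

Lemma ramp_eq0 (R : realType) (x : R) : x <= 0 -> ramp R x = 0.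
Proof. by move=> x0; rewrite /ramp; apply/max_idPr. Qed.

Lemma rampP (R : realType) (x : R) :
  (x <= 0 /\ ramp R x = 0) \/ (0 < x /\ ramp R x = x).
Proof.
have [x0|x0] := leP x 0; [left|right]; split => //; first exact: ramp_eq0.
by apply: ramp_id; exact: ltW.
Qed.

Lemma ramp_dist (R : realType) (x y : R) : x <= y ->
  0 <= ramp R y - ramp R x <= y - x.
Proof.
move=> xy; have [[x0 ->]|[x0 ->]] := rampP R x; have [[y0 ->]|[y0 ->]] := rampP R y; lra.
Qed.

Lemma ramp_sqr_taylor (R : realType) (x y : R) :
  `|ramp R y ^+ 2 / 2 - ramp R x ^+ 2 / 2 - ramp R x * (y - x)| <= (y - x) ^+ 2 / 2.
Proof.
have sq := sqr_ge0 (y - x).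
rewrite ler_norml; have [[x0 ->]|[x0 ->]] := rampP R x; have [[y0 ->]|[y0 ->]] := rampP R y.
- by rewrite expr0n/=; lra.
- rewrite expr0n/= [(y - x) ^+ 2](_ : _ = y ^+ 2 + (- x) * (y + (y - x))); last by ring.
  have : 0 <= (- x) * (y + (y - x)) by rewrite mulr_ge0//; lra.
  by have := sqr_ge0 y; lra.
- rewrite expr0n/= [(y - x) ^+ 2](_ : _ = x ^+ 2 - 2 * (x * y) + y ^+ 2); last by ring.
  have : 0 <= x * - y by rewrite mulr_ge0//; lra.
  have := sqr_ge0 x; have := sqr_ge0 y.
  by rewrite !expr2; lra.
- by rewrite (_ : _ - _ - _ = (y - x) ^+ 2 / 2); [lra|field].
Qed.

(** When x and y are both positive the remainder is (y - x)^2 ((y - x) / 6 + x / 2), whence a factor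
    growing with |x|; the mixed cases have the kink between x and y. *)
Lemma ramp_cube_taylor (R : realType) (x y : R) : `|y - x| < 1 ->
  `|ramp R y ^+ 3 / 6 - ramp R x ^+ 3 / 6 - ramp R x ^+ 2 / 2 * (y - x)| <=
  (`|x| + 1) * (y - x) ^+ 2.
Proof.
rewrite ltr_norml ler_norml => /andP[h1 h2].
have sq := sqr_ge0 (y - x).
have [[x0 ->]|[x0 ->]] := rampP R x; have [[y0 ->]|[y0 ->]] := rampP R y;
  rewrite ?(ler0_norm x0) ?(gtr0_norm x0) ?expr0n/=.
- have : 0 <= (- x + 1) * (y - x) ^+ 2 by rewrite mulr_ge0//; lra.
  by lra.
- have : y * y ^+ 2 <= y * (y - x) ^+ 2 by rewrite ler_pM2l// lerXn2r ?nnegrE; lra.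
  have : 0 <= y ^+ 3 by rewrite exprn_ge0// ltW.
  have : (y - 1 - x) * (y - x) ^+ 2 <= 0 by rewrite mulr_le0_ge0//; lra.
  have : 0 <= (- x) * (y - x) ^+ 2 by rewrite mulr_ge0//; lra.
  rewrite -exprS; lra.
- rewrite (_ : _ - _ - _ = x ^+ 2 * (x / 3 - y / 2)); last by field.
  have : 0 <= x ^+ 2 * (x / 3 - y / 2) by rewrite mulr_ge0 ?sqr_ge0//; lra.
  have : x ^+ 2 * (x / 3 - y / 2) <= (x - y) ^+ 2 * (x + 1).
    apply: ler_pM; rewrite ?sqr_ge0//; try lra.
    by rewrite lerXn2r ?nnegrE; lra.
  have -> : (x - y) ^+ 2 = (y - x) ^+ 2 by ring.
  lra.
- rewrite (_ : _ - _ - _ = (y - x) ^+ 2 * ((y - x) / 6 + x / 2)); last by field.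
  by rewrite (mulrC (x + 1)) -mulrN !ler_wpM2l//; lra.
Qed.

Lemma W11_ramp_subl (R : realType) (a : R) : W11 (fun t => ramp R (a - t)).
Proof.
apply: (abs_continuous_lipschitz _ _ _ 1) => x y _ xy _.
have : a - y <= a - x by lra.
by move=> /(ramp_dist R); rewrite ler_norml; lra.
Qed.

Lemma W11_ramp_subr (R : realType) (a : R) : W11 (fun t => ramp R (t - a)).
Proof.
apply: (abs_continuous_lipschitz _ _ _ 1) => x y _ xy _.
have : x - a <= y - a by lra.
by move=> /(ramp_dist R); rewrite ler_norml; lra.
Qed.

(* The ramps at 1/2 - b and 1/2 + b encode A + c * clamp(t - 1/2), clamped to [-b, b]. *)
Definition ctrl (R : realType) (A c b t : R) : R :=
  A + c * (ramp R (t - (2^-1 - b)) - ramp R (t - (2^-1 + b)) - b).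

Lemma ctrl_lipschitz (R : realType) (A c b x y : R) : x <= y ->
  `|ctrl R A c b y - ctrl R A c b x| <= (`|c| * 2) * (y - x).
Proof.
move=> xy; rewrite /ctrl.
have := ramp_dist R (x - (2^-1 - b)) (y - (2^-1 - b)).
have := ramp_dist R (x - (2^-1 + b)) (y - (2^-1 + b)).
rewrite !lerD2r => /(_ xy) h1 /(_ xy) h2.
move: h1 h2; set p2 := ramp R (y - (2^-1 + b)); set q2 := ramp R (x - (2^-1 + b)).
set p1 := ramp R (y - (2^-1 - b)); set q1 := ramp R (x - (2^-1 - b)) => h1 h2.
rewrite (_ : _ - _ = c * ((p1 - q1) - (p2 - q2))); last by ring.
by rewrite normrM -mulrA ler_wpM2l// ler_norml; lra.
Qed.

Lemma W11_ctrl (R : realType) (A c b : R) : W11 (ctrl R A c b).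
Proof.
by apply: (abs_continuous_lipschitz _ _ _ (`|c| * 2)) => x y _ xy _; exact: ctrl_lipschitz.
Qed.

(** The clamp is odd about 1/2, so the final velocity is right for all [c] and [b]; the equation
    relating them is exactly the final position condition. *)
Lemma steers_ctrl (R : realType) (s0 sf v0 vf c b : R) :
  0 <= b <= 2^-1 ->
  c * (b / 2 - 2 * b ^+ 3 / 3) = - (2 * (sf - s0) - vf - v0) ->
  steers s0 sf v0 vf (ctrl R (vf - v0) c b).
Proof.
move=> b01 hc; set A := vf - v0; set u := ctrl R A c b.
pose a1 := 2^-1 - b; pose a2 := 2^-1 + b.
(* The trajectory is explicit: ramp^2 / 2 and ramp^3 / 6 are the successive primitives of a ramp. *)
pose x2 t := v0 + A * t + c * (ramp R (t - a1) ^+ 2 / 2 - ramp R (t - a2) ^+ 2 / 2 - b * t).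
pose x1 t := s0 + v0 * t + A * t ^+ 2 / 2 +
  c * (ramp R (t - a1) ^+ 3 / 6 - ramp R (t - a2) ^+ 3 / 6 - b * t ^+ 2 / 2).
have shift (x y a : R) : y - a - (x - a) = y - x by ring.
have dx2 t : is_derive t (1 : R) x2 (u t).
  apply: (is_derive1_quadratic _ _ _ _ `|c|) => // y _.
  have := ramp_sqr_taylor R (t - a1) (y - a1); rewrite shift.
  have := ramp_sqr_taylor R (t - a2) (y - a2); rewrite shift.
  rewrite /x2 /u /ctrl -/a1 -/a2.
  set p1 := ramp R _; set p2 := ramp R _; set q1 := ramp R _; set q2 := ramp R _ => h1 h2.
  rewrite (_ : _ - _ - _ = c * ((q1 ^+ 2 / 2 - q2 ^+ 2 / 2 - q2 * (y - t)) - (p1 ^+ 2 / 2 - p2 ^+ 2 / 2 - p2 * (y - t)))); last by ring.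
  by rewrite normrM ler_wpM2l//; apply: le_trans (ler_normB _ _) _; lra.
have dx1 t : is_derive t (1 : R) x1 (x2 t).
  apply: (is_derive1_quadratic _ _ _ _ (`|A| + `|c| * (`|t - a1| + `|t - a2| + 2 + `|b|))) => [|y yt].
    by have := normr_ge0 A; have := normr_ge0 c; have := normr_ge0 (t - a1); have := normr_ge0 (t - a2); have := normr_ge0 b; nra.
  have := ramp_cube_taylor R (t - a1) (y - a1); rewrite shift => /(_ yt).
  have := ramp_cube_taylor R (t - a2) (y - a2); rewrite shift => /(_ yt).
  rewrite /x1 /x2.
  set p1 := ramp R _; set p2 := ramp R _; set q1 := ramp R _; set q2 := ramp R _ => h1 h2.
  rewrite (_ : _ - _ - _ = A * ((y - t) ^+ 2 / 2) + c * (((q1 ^+ 3 / 6 - q2 ^+ 3 / 6 - q2 ^+ 2 / 2 * (y - t)) - (p1 ^+ 3 / 6 - p2 ^+ 3 / 6 - p2 ^+ 2 / 2 * (y - t))) - b * ((y - t) ^+ 2 / 2))); last by field.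
  apply: le_trans (ler_normD _ _) _; rewrite (normrM A) (normrM c) mulrDl -(mulrA `|c|).
  apply: lerD; first by rewrite ler_wpM2l// ger0_norm; have := sqr_ge0 (y - t); lra.
  rewrite ler_wpM2l//; apply: le_trans (ler_normB _ _) _; rewrite (normrM b).
  apply: le_trans (lerD (ler_normB _ _) (lexx _)) _.
  have s0' := sqr_ge0 (y - t).
  rewrite (ger0_norm (x := (y - t) ^+ 2 / 2)); last by lra.
  have : 0 <= `|b| * (y - t) ^+ 2 by rewrite mulr_ge0.
  by lra.
have r01 : ramp R (0 - a1) = 0 by apply: ramp_eq0; rewrite /a1; lra.
have r02 : ramp R (0 - a2) = 0 by apply: ramp_eq0; rewrite /a2; lra.
have r11 : ramp R (1 - a1) = 1 - a1 by apply: ramp_id; rewrite /a1; lra.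
have r12 : ramp R (1 - a2) = 1 - a2 by apply: ramp_id; rewrite /a2; lra.
have ac2 := abs_continuous_C1 _ 0 1 _ _ dx2 (abs_continuous_within _ _ _ _ (W11_ctrl R A c b)).
exists x1, x2; split.
- split => //; exact: (abs_continuous_C1 _ _ _ _ _ dx1 (abs_continuous_within _ _ _ _ ac2)).
- by apply: aeW => t _; exact: dx1.
- by apply: aeW => t _; exact: dx2.
- by rewrite /x1 r01 r02 r11 r12 /a1 /a2 /A; split; [field|move: hc; rewrite !expr2 !exprS; lra].
- by rewrite /x2 r01 r02 r11 r12 /a1 /a2 /A; split; [field|lra].
Qed.

(** * Moment conditions and integrability *)

Lemma W11_id (R : realType) : W11 (@id R).
Proof.
by apply: (abs_continuous_lipschitz _ _ _ 1) => x y _ xy _; rewrite mul1r ger0_norm ?subr_ge0.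
Qed.

Lemma W11_cst (R : realType) (k : R) : W11 (fun _ : R => k).
Proof.
by apply: (abs_continuous_lipschitz _ _ _ 0) => x y _ xy _; rewrite mul0r subrr normr0.
Qed.

(** The second moment comes from integrating the derivative t v + x2 of t x2 and subtracting the
    integral of x2, which is sf - s0. *)
Lemma steers_moments (R : realType) (s0 sf v0 vf : R) (v : R -> R) :
  steers s0 sf v0 vf v ->
  (@lebesgue_measure R).-integrable `[0, 1] (EFin \o v) ->
  (@lebesgue_measure R).-integrable `[0, 1] (EFin \o (fun t => t * v t)) ->
  \int[@lebesgue_measure R]_(t in `[0, 1]) v t = vf - v0 /\
  \int[@lebesgue_measure R]_(t in `[0, 1]) (t * v t) = vf - (sf - s0).
Proof.
move=> [x1 [x2 [[ac1 ac2] d1 d2 [x10 x11] [x20 x21]]]] iv itv.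
have ff := ae_filter_ringOfSetsType (@lebesgue_measure R).
have ix2 : (@lebesgue_measure R).-integrable `[0, 1] (EFin \o x2).
  by apply: continuous_compact_integrable; [exact: segment_compact|exact: abs_continuous_within].
split; first by rewrite (abs_continuous_FTC _ x2)// x21 x20.
have := abs_continuous_FTC _ _ (fun t => t * v t + x2 t) (abs_continuousM _ _ _ _ _ (W11_id R) ac2).
rewrite /= mul1r mul0r subr0 x21 RintegralD// (abs_continuous_FTC _ x1 x2)// x10 x11 => H.
rewrite -H ?addrK//; last exact: (integrableD _ itv ix2).
apply: filterS d2 => t d2 t01.
apply: is_derive_eq; first exact: is_deriveM (is_derive_id t 1) (d2 t01).
by rewrite /= /GRing.scale/= mulr1.
Qed.

Lemma W11_square_integrable (R : realType) (u : R -> R) : W11 u -> square_integrable u.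
Proof.
move=> acu; split.
  apply: subspace_continuous_measurable_fun; first exact: measurable_itv.
  exact: abs_continuous_within.
apply: continuous_compact_integrable; first exact: segment_compact.
exact: abs_continuous_within (abs_continuousM _ _ _ _ _ acu acu).
Qed.

Lemma square_integrable_mul (R : realType) (u v : R -> R) :
  square_integrable u -> square_integrable v ->
  (@lebesgue_measure R).-integrable `[0, 1] (EFin \o (fun t => u t * v t)).
Proof.
move=> [mu iu] [mv iv].
apply: (le_integrable _ _ _ (integrableD _ iu iv)) => //.
  by apply/measurable_EFinP; exact: measurable_funM.
move=> t _ /=; rewrite lee_fin.
rewrite (ger0_norm (x := _ + _)) ?addr_ge0 ?sqr_ge0// ler_norml.
have := sqr_ge0 (u t - v t); have := sqr_ge0 (u t + v t); have := sqr_ge0 (u t); have := sqr_ge0 (v t).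
by rewrite !expr2; lra.
Qed.

Lemma Rintegral_ramp (R : realType) (a : R) : 0 <= a -> a <= 1 ->
  \int[@lebesgue_measure R]_(t in `[0, 1]) ramp R (a - t) = a ^+ 2 / 2 /\
  \int[@lebesgue_measure R]_(t in `[0, 1]) ramp R (t - (1 - a)) = a ^+ 2 / 2.
Proof.
move=> a0 a1.
have W1 := W11_ramp_subl R a.
have W2 := W11_ramp_subr R (1 - a).
have iW (f : R -> R) : W11 f -> (@lebesgue_measure R).-integrable `[0, 1] (EFin \o f).
  move=> W; apply: continuous_compact_integrable; first exact: segment_compact.
  exact: abs_continuous_within.
have d1 t : is_derive t (1 : R) (fun t => - (ramp R (a - t) ^+ 2 / 2)) (ramp R (a - t)).
  apply: (is_derive1_quadratic _ _ _ _ 1) => // y _.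
  have := ramp_sqr_taylor R (a - t) (a - y); have := sqr_ge0 (y - t).
  rewrite (_ : a - y - (a - t) = - (y - t)); last by ring.
  rewrite sqrrN (_ : - _ - - _ - _ = - (ramp R (a - y) ^+ 2 / 2 - ramp R (a - t) ^+ 2 / 2 - ramp R (a - t) * - (y - t))); last by ring.
  by rewrite normrN; lra.
have d2 t : is_derive t (1 : R) (fun t => ramp R (t - (1 - a)) ^+ 2 / 2) (ramp R (t - (1 - a))).
  apply: (is_derive1_quadratic _ _ _ _ 1) => // y _.
  have := ramp_sqr_taylor R (t - (1 - a)) (y - (1 - a)); have := sqr_ge0 (y - t).
  rewrite (_ : y - (1 - a) - (t - (1 - a)) = y - t); last by ring.
  by lra.
split.
- rewrite (abs_continuous_FTC R _ _ (abs_continuous_C1 _ _ _ _ _ d1 (abs_continuous_within _ _ _ _ W1)))//.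
  + rewrite subr0 (ramp_id _ a)// ramp_eq0; last by lra.
    by field.
  + by apply: aeW => t _; exact: d1.
  + exact: iW.
- rewrite (abs_continuous_FTC R _ _ (abs_continuous_C1 _ _ _ _ _ d2 (abs_continuous_within _ _ _ _ W2)))//.
  + rewrite (ramp_eq0 _ (0 - _)); last by lra.
    rewrite ramp_id; last by lra.
    by field.
  + by apply: aeW => t _; exact: d2.
  + exact: iW.
Qed.

(** * Lower bound for the energy gap *)

Lemma ctrlE (R : realType) (A c b t : R) :
  ctrl R A c b t =
  A + c * (t - 2^-1) + c * (ramp R (2^-1 - b - t) - ramp R (t - (2^-1 + b))).
Proof.
(* At the left kink, x^+ = x + (-x)^+ replaces the ramp by an affine function and a correction near
   0. *)
rewrite /ctrl; have [[h1 ->]|[h1 ->]] := rampP R (t - (2^-1 - b));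
  have [[h2 ->]|[h2 ->]] := rampP R (2^-1 - b - t); try by ring.
- have -> : b = 2^-1 - t by lra.
  by ring.
- by exfalso; lra.
Qed.

(* Convexity: u (v - u) is bounded below by terms whose integrals only involve the two moments of v. *)
Lemma ctrl_pointwise_gap (R : realType) (A c b m M t x : R) : 0 <= b ->
  let r1 := ramp R (2^-1 - b - t) in let r2 := ramp R (t - (2^-1 + b)) in
  let u := ctrl R A c b t in
  0 <= r1 * (c * x - m) -> 0 <= r2 * (M - c * x) ->
  (A - c / 2) * (x - u) + c * (t * x - t * u) +
    ((m - c * A + c ^+ 2 * b) * r1 - (M - c * A - c ^+ 2 * b) * r2) <= u * x - u * u.
Proof.
move=> b0 r1 r2 u h1 h2.
(* Where [r1] is nonzero the control is saturated at A - c b; where [r2] is nonzero, at A + c b. *)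
have e1 : r1 * u = r1 * (A - c * b).
  rewrite /u /ctrl /r1; have [[h ->]|[h _]] := rampP R (2^-1 - b - t); first by rewrite !mul0r.
  rewrite (ramp_eq0 _ (t - (2^-1 - b))); last by lra.
  by rewrite (ramp_eq0 _ (t - (2^-1 + b))); [congr (_ * _); ring|lra].
have e2 : r2 * u = r2 * (A + c * b).
  rewrite /u /ctrl /r2; have [[h ->]|[h ->]] := rampP R (t - (2^-1 + b)); first by rewrite !mul0r.
  by rewrite ramp_id; [congr (_ * _); ring|lra].
have uE : u = A + c * (t - 2^-1) + c * (r1 - r2) := ctrlE R A c b t.
have -> : u * x - u * u = (A + c * (t - 2^-1)) * (x - u) + c * (r1 * x - r2 * x - (r1 * u - r2 * u)).
  by rewrite -mulrBr {1}uE; ring.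
rewrite e1 e2; move: h1 h2 => /=; rewrite !expr2; lra.
Qed.

(** Integrate the pointwise gap: equal moments cancel the affine part, each ramp contributes (1/2 -
    b)^2 / 2, and v^2 = u^2 + 2 u (v - u) + (v - u)^2. The bounds [m] and [M] on [c * v t] are
    weighted by the ramps, hence bind only near the ends, and nowhere on [0, 1] when b = 1/2. *)
Lemma ctrl_energy_gap (R : realType) (A c b K m M : R) (v : R -> R) :
  let u := ctrl R A c b in
  0 <= b <= 2^-1 -> square_integrable v ->
  \int[@lebesgue_measure R]_(t in `[0, 1]) u t = A ->
  \int[@lebesgue_measure R]_(t in `[0, 1]) (t * u t) = K ->
  \int[@lebesgue_measure R]_(t in `[0, 1]) v t = A ->
  \int[@lebesgue_measure R]_(t in `[0, 1]) (t * v t) = K ->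
  (forall t, 0 <= t <= 1 -> 0 <= ramp R (2^-1 - b - t) * (c * v t - m) /\
     0 <= ramp R (t - (2^-1 + b)) * (M - c * v t)) ->
  2^-1 * (\int[@lebesgue_measure R]_(t in `[0, 1]) (u t ^+ 2)) +
  2^-1 * (\int[@lebesgue_measure R]_(t in `[0, 1]) ((v t - u t) ^+ 2)) +
  (2^-1 - b) ^+ 2 / 2 * (m - M + 2 * c ^+ 2 * b) <=
  2^-1 * (\int[@lebesgue_measure R]_(t in `[0, 1]) (v t ^+ 2)).
Proof.
move=> u b01 sv uA uK vA vK mM.
have su : square_integrable u by apply: W11_square_integrable; exact: W11_ctrl.
have mI : measurable (`[0%R, 1%R]%classic : set (measurableTypeR R)) by exact: measurable_itv.
pose int (f : R -> R) := (@lebesgue_measure R).-integrable `[0, 1] (EFin \o f).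
have sc k : square_integrable (fun _ : R => k) by apply: W11_square_integrable; exact: W11_cst.
have sid : square_integrable (@id R) by apply: W11_square_integrable; exact: W11_id.
have i1 (f : R -> R) : square_integrable f -> int f.
  move=> sf; have := square_integrable_mul _ _ _ (sc 1) sf; congr (integrable _ _ _).
  by apply/funext => t /=; rewrite mul1r.
have iZ k (f : R -> R) : int f -> int (fun t => k * f t).
  by move=> jf; exact: (integrableZl mI k jf).
have iD (f g : R -> R) : int f -> int g -> int (fun t => f t + g t).
  by move=> jf jg; exact: (integrableD mI jf jg).
have iB (f g : R -> R) : int f -> int g -> int (fun t => f t - g t).
  by move=> jf jg; exact: (integrableB mI jf jg).
have [r1I r2I] := Rintegral_ramp R (2^-1 - b) ltac:(lra) ltac:(lra).
rewrite (_ : 1 - (2^-1 - b) = 2^-1 + b) in r2I; last by field.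
have W1 := W11_ramp_subl R (2^-1 - b).
have W2 := W11_ramp_subr R (2^-1 + b).
have j1 := i1 _ (W11_square_integrable _ _ W1).
have j2 := i1 _ (W11_square_integrable _ _ W2).
have ju := i1 _ su; have jv := i1 _ sv.
have jtu := square_integrable_mul _ _ _ sid su.
have jtv := square_integrable_mul _ _ _ sid sv.
have juv := square_integrable_mul _ _ _ su sv.
have juu := square_integrable_mul _ _ _ su su.
have jvv := square_integrable_mul _ _ _ sv sv.
set k1 := m - c * A + c ^+ 2 * b; set k2 := M - c * A - c ^+ 2 * b.
have jl := iD _ _ (iZ (A - c / 2) _ (iB _ _ jv ju)) (iZ c _ (iB _ _ jtv jtu)).
have jr := iB _ _ (iZ k1 _ j1) (iZ k2 _ j2).
have jh : int (fun t => (A - c / 2) * (v t - u t) + c * (t * v t - t * u t) +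
   (k1 * ramp R (2^-1 - b - t) - k2 * ramp R (t - (2^-1 + b)))).
  exact: (iD _ _ jl jr).
have := le_Rintegral mI jh (iB _ _ juv juu) _.
rewrite (RintegralD mI jl jr).
rewrite (RintegralD mI (iZ _ _ (iB _ _ jv ju)) (iZ _ _ (iB _ _ jtv jtu))).
rewrite (RintegralZl _ mI (iB _ _ jv ju)) (RintegralZl _ mI (iB _ _ jtv jtu)).
rewrite (RintegralB mI jv ju) (RintegralB mI jtv jtu).
rewrite (RintegralB mI (iZ _ _ j1) (iZ _ _ j2)) (RintegralZl _ mI j1) (RintegralZl _ mI j2).
rewrite (RintegralB mI juv juu) r1I r2I uA uK vA vK => gap.
have -> : \int[@lebesgue_measure R]_(t in `[0, 1]) ((v t - u t) ^+ 2) =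
  \int[@lebesgue_measure R]_(t in `[0, 1]) (v t * v t) -
  2 * \int[@lebesgue_measure R]_(t in `[0, 1]) (u t * v t) +
  \int[@lebesgue_measure R]_(t in `[0, 1]) (u t * u t).
  rewrite -(RintegralZl _ mI juv) -(RintegralB mI jvv (iZ _ _ juv)).
  rewrite -(RintegralD mI (iB _ _ jvv (iZ _ _ juv)) juu).
  by apply: eq_Rintegral => t _; ring.
have -> : \int[@lebesgue_measure R]_(t in `[0, 1]) (u t ^+ 2) = \int[@lebesgue_measure R]_(t in `[0, 1]) (u t * u t).
  by apply: eq_Rintegral => t _; rewrite expr2.
have -> : \int[@lebesgue_measure R]_(t in `[0, 1]) (v t ^+ 2) = \int[@lebesgue_measure R]_(t in `[0, 1]) (v t * v t).
  by apply: eq_Rintegral => t _; rewrite expr2.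
suff : (2^-1 - b) ^+ 2 / 2 * (m - M + 2 * c ^+ 2 * b) <=
    \int[@lebesgue_measure R]_(t in `[0, 1]) (u t * v t) -
    \int[@lebesgue_measure R]_(t in `[0, 1]) (u t * u t) by lra.
apply: le_trans (gap _) => [|t].
  by rewrite /k1 /k2 !subrr !mulr0 !add0r -mulrBl mulrC ler_wpM2r//; [have := sqr_ge0 (2^-1 - b); lra|lra].
rewrite /= in_itv/= => t01; have [h1 h2] := mM t t01.
by apply: ctrl_pointwise_gap => //; lra.
Qed.

(** * Total variation of monotone functions *)

(** The sign of [s] tells nondecreasing from nonincreasing, so parameters of either sign are handled
    by one argument. *)
Lemma monotone_total_variation (R : realType) (a b : R) (f : R -> R) (s : R) :
  a <= b -> (forall x y, a <= x -> x <= y -> y <= b -> 0 <= s * (f y - f x)) -> s != 0 ->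
  total_variation a b f = `|f b - f a|%:E.
Proof.
move=> ab fs; rewrite neq_lt => /orP[s0|s0].
- rewrite -total_variationN nondecreasing_total_variation//=.
    congr EFin; rewrite ler0_norm; first by lra.
    by have := fs a b (lexx _) ab (lexx _); rewrite nmulr_rge0.
  move=> x y; rewrite !in_itv/= => /andP[ax _] /andP[_ yb] xy.
  by have := fs x y ax xy yb; rewrite nmulr_rge0// subr_le0 lerN2.
- rewrite nondecreasing_total_variation//=.
    congr EFin; rewrite ger0_norm//.
    by have := fs a b (lexx _) ab (lexx _); rewrite pmulr_rge0.
  move=> x y; rewrite !in_itv/= => /andP[ax _] /andP[_ yb] xy.
  by have := fs x y ax xy yb; rewrite pmulr_rge0// subr_ge0.
Qed.

Lemma dist_le_total_variation (R : realType) (a b x y : R) (f : R -> R) :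
  a <= x <= b -> a <= y <= b ->
  (`|f y - f x|%:E <= total_variation a b f)%E.
Proof.
wlog xy : x y / x <= y.
  move=> H hx hy; have [xy|/ltW yx] := leP x y; first exact: H.
  by rewrite distrC; exact: H.
move=> /andP[ax xb] /andP[ay yb].
rewrite (total_variationD f ax xb) (total_variationD f xy yb).
apply: le_trans (total_variation_ge f xy) _.
have h1 := total_variation_ge0 f ax; have h2 := total_variation_ge0 f yb.
by apply: le_trans (leeDr _ h1); apply: leeDl.
Qed.

Lemma ctrl_endpoints (R : realType) (A c b : R) : 0 <= b <= 2^-1 ->
  ctrl R A c b 0 = A - c * b /\ ctrl R A c b 1 = A + c * b.
Proof.
move=> b01; rewrite /ctrl; split.
  by rewrite !ramp_eq0; [ring|lra|lra].
by rewrite !ramp_id; [field|lra|lra].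
Qed.

(** The clamp is monotone, so only the end values count. Agreement on [0, 1] is assumed instead of
    equality because minimizers are determined only there. *)
Lemma total_variation_ctrl (R : realType) (A c b : R) (u : R -> R) :
  0 <= b <= 2^-1 -> (forall t, 0 <= t <= 1 -> u t = ctrl R A c b t) ->
  TV01 u = (2 * `|c| * b)%:E.
Proof.
move=> b01 uE; have [e0 e1] := ctrl_endpoints R A c b b01.
pose s := if c < 0 then -1 else 1 : R.
rewrite /TV01 (monotone_total_variation R 0 1 _ s)//.
- rewrite !uE ?lexx ?ler01// e0 e1 (_ : _ - _ = 2 * c * b); last by ring.
  by rewrite !normrM (ger0_norm (x := b)) ?(ger0_norm (x := 2))//; lra.
- move=> x y x0 xy y1; rewrite (uE x) ?(uE y); [|lra|lra].
  rewrite /ctrl.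
  set g := fun t => ramp R (t - (2^-1 - b)) - ramp R (t - (2^-1 + b)).
  have gm : 0 <= g y - g x.
    rewrite /g.
    have [[? ->]|[? ->]] := rampP R (x - (2^-1 - b)); have [[? ->]|[? ->]] := rampP R (x - (2^-1 + b));
    have [[? ->]|[? ->]] := rampP R (y - (2^-1 - b)); have [[? ->]|[? ->]] := rampP R (y - (2^-1 + b)); lra.
  rewrite (_ : s * _ = (s * c) * (g y - g x)); last by rewrite /g; ring.
  by rewrite mulr_ge0// /s; case: ltP => c0; lra.
- by rewrite /s; case: ifP => _; rewrite ?oppr_eq0 oner_eq0.
Qed.

(** * Optimality and uniqueness of the clamped controls *)

Lemma energyE (R : realType) (v : R -> R) : square_integrable v ->
  energy v = (2^-1 * \int[@lebesgue_measure R]_(t in `[0, 1]) (v t ^+ 2))%:E.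
Proof.
move=> [_ iv]; rewrite /energy EFinM /Rintegral fineK//.
exact: integrable_fin_num iv.
Qed.

(** The relation between [alpha], [c] and [b] turns the boundary term of the energy gap into alpha
    (TV u - TV v). Allowing [alpha = 0] covers the minimum-energy problem, and [c = 0] covers
    constant controls. *)
Lemma ctrl_optimal (R : realType) (s0 sf v0 vf c b alpha : R) (v : R -> R) :
  let u := ctrl R (vf - v0) c b in
  0 <= b <= 2^-1 -> 0 <= alpha ->
  c * (b / 2 - 2 * b ^+ 3 / 3) = - (2 * (sf - s0) - vf - v0) ->
  c = 0 \/ alpha = `|c| * ((2^-1 - b) ^+ 2 / 2) ->
  square_integrable v -> steers s0 sf v0 vf v ->
  (tv_cost alpha u + (2^-1 * \int[@lebesgue_measure R]_(t in `[0, 1]) ((v t - u t) ^+ 2))%:E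
    <= tv_cost alpha v)%E.
Proof.
move=> u b01 al0 hc ha sv stv.
have su : square_integrable u by apply: W11_square_integrable; exact: W11_ctrl.
have mom w : square_integrable w -> steers s0 sf v0 vf w ->
  \int[@lebesgue_measure R]_(t in `[0, 1]) w t = vf - v0 /\
  \int[@lebesgue_measure R]_(t in `[0, 1]) (t * w t) = vf - (sf - s0).
  move=> sw stw; apply: (steers_moments R s0 sf v0 vf) => //.
    have := square_integrable_mul _ _ _ (W11_square_integrable R _ (W11_cst R 1)) sw.
    by congr (integrable _ _ _); apply/funext => t /=; rewrite mul1r.
  exact: square_integrable_mul (W11_square_integrable R _ (W11_id R)) sw.
have [uA uK] := mom u su (steers_ctrl R s0 sf v0 vf c b b01 hc).
have [vA vK] := mom v sv stv.
have gap := fun m M => ctrl_energy_gap R _ c b _ m M v b01 sv uA uK vA vK.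
rewrite /tv_cost (energyE R u su) (energyE R v sv) (total_variation_ctrl R (vf - v0) c b)//.
move: gap; rewrite -/u.
set U := 2^-1 * (\int[@lebesgue_measure R]_(t in `[0, 1]) (u t ^+ 2)).
set V := 2^-1 * (\int[@lebesgue_measure R]_(t in `[0, 1]) (v t ^+ 2)).
set W := 2^-1 * (\int[@lebesgue_measure R]_(t in `[0, 1]) ((v t - u t) ^+ 2)) => gap.
have tv0 : (0 <= TV01 v)%E by exact: total_variation_ge0.
(* Any real lower bound [k] of the variation term of v reduces the claim to real numbers. *)
have main k : (k%:E <= alpha%:E * TV01 v)%E -> U + alpha * (2 * `|c| * b) + W <= V + k ->
  (U%:E + alpha%:E * (2 * `|c| * b)%:E + W%:E <= V%:E + alpha%:E * TV01 v)%E.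
  move=> hk h; apply: (@le_trans _ _ (V%:E + k%:E)%E).
    by rewrite -EFinM -!EFinD lee_fin.
  exact: leeD2l.
have [c0|c0] := eqVneq c 0.
  apply: (main 0); first by rewrite mule_ge0// lee_fin.
  have := gap 0 0; rewrite c0 normr0 !(mulr0, mul0r, expr0n)/= !(subrr,addr0,mulr0).
  by apply => t _; rewrite mul0r subrr !mulr0.
case: ha => [/eqP|ha]; first by rewrite (negbTE c0).
(* With [c] nonzero, [alpha = 0] forces b = 1/2; both ramps vanish on [0, 1] and [m = M = 0] is
   admissible. *)
have [al|al] := eqVneq alpha 0.
  apply: (main 0); first by rewrite mule_ge0// lee_fin.
  have a0 : 2^-1 - b = 0.
    move: al; rewrite ha => /eqP; rewrite mulf_eq0 normr_eq0 (negbTE c0)/=.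
    by rewrite mulf_eq0 invr_eq0 pnatr_eq0 orbF expf_eq0/= => /eqP.
  have := gap 0 0; rewrite al a0 expr0n/= !mul0r !addr0; apply => t /andP[t0 t1].
  by rewrite !ramp_eq0 ?mul0r//; lra.
have {}al : 0 < alpha by rewrite lt_neqAle eq_sym al.
have : forall t w, 0 <= t <= 1 -> 0 <= w <= 1 -> (`|v w - v t|%:E <= TV01 v)%E.
  by move=> t w; exact: dist_le_total_variation.
case: (TV01 v) tv0 main => [T| |//] tv0 main dist.
- have bdT t w : 0 <= t <= 1 -> 0 <= w <= 1 -> `|c| * `|v w - v t| <= `|c| * T.
    by move=> t01 w01; rewrite ler_wpM2l// -lee_fin dist.
  pose S := [set c * v t | t in `[0, 1]].
  have S0 : S !=set0 by exists (c * v 0), 0 => //=; rewrite in_itv/= lexx ler01.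
  have cvB t w : 0 <= t <= 1 -> 0 <= w <= 1 -> c * v w <= c * v t + `|c| * T.
    move=> t01 w01; rewrite -lerBlDl -mulrBr; apply: le_trans (bdT t w t01 w01).
    by rewrite -normrM ler_norm.
  have hS : has_sup S.
    split=> //; exists (c * v 0 + `|c| * T) => x [t /=]; rewrite in_itv/= => t01 <-.
    by apply: cvB => //; rewrite lexx ler01.
  apply: (main (alpha * T)); first by rewrite EFinM.
  (* The oscillation of c v is at most |c| T, so its supremum lowered by |c| T is a lower bound;
     then M - m = |c| T. *)
  have := gap (sup S - `|c| * T) (sup S).
  have -> : (2^-1 - b) ^+ 2 / 2 * (sup S - `|c| * T - sup S + 2 * c ^+ 2 * b) = alpha * (2 * `|c| * b) - alpha * T.
    by rewrite ha -(@real_normK _ c) ?num_real//; ring.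
  move=> {}gap; suff : U + W + (alpha * (2 * `|c| * b) - alpha * T) <= V by lra.
  apply: gap => t t01; split; rewrite mulr_ge0 ?ramp_ge0// subr_ge0.
    rewrite lerBlDr; apply: ge_sup => // x [w /=]; rewrite in_itv/= => w01 <-.
    exact: cvB.
  by apply: sup_upper_bound => //; exists t => //=; rewrite in_itv.
- by rewrite gt0_muley ?lte_fin// addey// leey.
Qed.

Lemma Rintegral_sqr_le0_eq0 (R : realType) (w : R -> R) :
  {within `[0, 1], continuous w} ->
  \int[@lebesgue_measure R]_(t in `[0, 1]) (w t ^+ 2) <= 0 ->
  forall t, 0 <= t <= 1 -> w t = 0.
Proof.
move=> cw w0 t t01; apply/eqP/negPn/negP => wt0.
pose e := `|w t| / 2; have e0 : 0 < e by rewrite divr_gt0 ?normr_gt0.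
have /cvgrPdist_lt/(_ e e0) : w x @[x --> within `[0, 1] (nbhs t)] --> w t.
  by move/subspace_continuousP : cw; apply; rewrite /= in_itv.
rewrite near_withinE => -[d /= d0 dw].
(* Truncation to [0, 1] keeps the interval nondegenerate even when [t] is an endpoint; on it |w| is
   at least half of |w t|. *)
pose l := Num.max 0 (t - d / 2); pose r := Num.min 1 (t + d / 2).
have lr : l < r by rewrite lt_min !gt_max; lra.
have l0 : 0 <= l by rewrite le_max lexx.
have r1 : r <= 1 by rewrite ge_min lexx.
have sub : `[l, r]%classic `<=` (`[0%R, 1%R]%classic : set R).
  by apply: subset_itvScc; rewrite bnd_simp.
have ew y : `[l, r]%classic y -> e ^+ 2 <= w y ^+ 2.
  move=> yl; have y01 := sub y yl; move: yl.
  rewrite /= in_itv/= ge_max le_min => /andP[/andP[_ h1] /andP[_ h2]].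
  have /dw : `|t - y| < d by rewrite ltr_norml; lra.
  move=> /(_ y01) => ty.
  rewrite -(real_normK (num_real (w y))) lerXn2r ?nnegrE//; first exact: ltW.
  have := ler_distD (w y) (w t) 0; rewrite !subr0 => h.
  by move: ty h; rewrite /e; lra.
have iw : (@lebesgue_measure R).-integrable `[0, 1] (EFin \o (fun t => w t ^+ 2)).
  apply: continuous_compact_integrable; first exact: segment_compact.
  by move=> x; apply: continuousM; exact: cw.
have : ((e ^+ 2 * (r - l))%:E <= (\int[@lebesgue_measure R]_(t in `[0, 1]) (w t ^+ 2))%:E)%E.
  rewrite /Rintegral fineK; last exact: integrable_fin_num iw.
  apply: (@le_trans _ _ (\int[@lebesgue_measure R]_(t in `[l, r]) (w t ^+ 2)%:E)%E).
    apply: (@le_trans _ _ (\int[@lebesgue_measure R]_(t in `[l, r]) (cst (e ^+ 2)%:E t))%E).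
      rewrite integral_cst; last exact: measurable_itv.
      by rewrite [X in (_ * X)%E](@lebesgue_measure_itv R `[l, r])/= lte_fin lr -EFinB -EFinM.
    apply: ge0_le_integral => //=.
    - by move=> x _; rewrite lee_fin sqr_ge0.
    - apply: measurable_int; apply: integrableS iw => //.
  apply: ge0_subset_integral => //; first exact: measurable_int iw.
  by move=> x _; rewrite lee_fin sqr_ge0.
rewrite lee_fin => /le_trans/(_ w0).
by rewrite leNgt mulr_gt0// ?exprn_gt0// subr_gt0.
Qed.

(** The lower bound of [ctrl_optimal] contains the squared L^2 distance to u. A cost not exceeding
    that of u, which is finite, makes it vanish, and continuity upgrades this to pointwise
    equality. *)
Lemma ctrl_unique (R : realType) (s0 sf v0 vf c b alpha : R) (v : R -> R) :
  let u := ctrl R (vf - v0) c b in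
  0 <= b <= 2^-1 -> 0 <= alpha ->
  c * (b / 2 - 2 * b ^+ 3 / 3) = - (2 * (sf - s0) - vf - v0) ->
  c = 0 \/ alpha = `|c| * ((2^-1 - b) ^+ 2 / 2) ->
  square_integrable v -> steers s0 sf v0 vf v -> {within `[0, 1], continuous v} ->
  (tv_cost alpha v <= tv_cost alpha u)%E -> forall t, 0 <= t <= 1 -> v t = u t.
Proof.
move=> u b01 al0 hc ha sv stv cv vu t t01.
have := le_trans (ctrl_optimal R s0 sf v0 vf c b alpha v b01 al0 hc ha sv stv) vu.
have su : square_integrable u by apply: W11_square_integrable; exact: W11_ctrl.
rewrite /tv_cost energyE// (total_variation_ctrl R (vf - v0) c b)//.
rewrite -EFinM -!EFinD lee_fin gerDl pmulr_rle0 ?invr_gt0// => /Rintegral_sqr_le0_eq0 H.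
apply/eqP; rewrite -subr_eq0; apply/eqP; apply: (H _ t t01).
move=> x; apply: continuousB; first exact: cv.
exact: (abs_continuous_within _ _ _ _ (W11_ctrl R (vf - v0) c b)).
Qed.

Lemma ctrl_minimal (R : realType) (s0 sf v0 vf c b alpha : R) (v : R -> R) :
  let u := ctrl R (vf - v0) c b in
  0 <= b <= 2^-1 -> 0 <= alpha ->
  c * (b / 2 - 2 * b ^+ 3 / 3) = - (2 * (sf - s0) - vf - v0) ->
  c = 0 \/ alpha = `|c| * ((2^-1 - b) ^+ 2 / 2) ->
  square_integrable v -> steers s0 sf v0 vf v ->
  (tv_cost alpha u <= tv_cost alpha v)%E.
Proof.
move=> u b01 al0 hc ha sv stv.
apply: le_trans (ctrl_optimal R s0 sf v0 vf c b alpha v b01 al0 hc ha sv stv).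
by apply: leeDl; rewrite lee_fin mulr_ge0// Rintegral_ge0// => t _; exact: sqr_ge0.
Qed.

(** * Parameters for a given alpha, and the limit as alpha tends to infinity *)

Lemma ctrl_parameters (R : realType) (D alpha : R) : 0 < alpha ->
  exists c b, [/\ 0 <= b <= 2^-1, c * (b / 2 - 2 * b ^+ 3 / 3) = - D,
    c = 0 \/ alpha = `|c| * ((2^-1 - b) ^+ 2 / 2) & alpha * b <= `|D|].
Proof.
move=> al0; have [->|D0] := eqVneq D 0.
  exists 0, 0; split; [lra|by rewrite mul0r oppr0|by left|by rewrite mulr0].
have nD0 : 0 < `|D| by rewrite normr_gt0.
(* Substituting c = -D / q with q = b/2 - 2 b^3 / 3 into the relation for [alpha] gives p(b) = 0.
   Here p(0) = -|D| / 4 and p(1/2) = alpha / 3 have opposite signs. *)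
pose p := alpha *: ('X - (4 / 3) *: 'X^3) - `|D| *: ((2^-1)%:P - 'X) ^+ 2 : {poly R}.
have pE x : p.[x] = alpha * (x - 4 / 3 * x ^+ 3) - `|D| * (2^-1 - x) ^+ 2.
  by rewrite /p !hornerE.
have [b] : exists2 b, b \in `[0, 2^-1] & root p b.
  apply: poly_ivt; first by rewrite invr_ge0.
  rewrite !pE subrr !expr0n/= !mulr0 subr0 mulr0 sub0r subr0 oppr_le0.
  rewrite mulr_ge0 ?sqr_ge0//= (_ : 2^-1 - 4 / 3 * 2^-1 ^+ 3 = 3^-1); last by field.
  by rewrite subr0 mulr_ge0// ltW.
rewrite in_itv/= => /andP[b0 b1]; rewrite /root pE subr_eq0 => /eqP hb.
have {}b0 : 0 < b.
  rewrite lt_neqAle b0 andbT; apply/negP => /eqP b00.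
  move: hb; rewrite -b00 expr0n/= !mulr0 subr0 mulr0 subr0 => /esym/eqP.
  by rewrite mulf_eq0 expf_eq0/= invr_eq0 pnatr_eq0 orbF gt_eqF.
have b2 : b ^+ 2 <= 4^-1 by rewrite expr2; nra.
(* From b^2 <= 1/4; this bounds q away from 0 and yields the decay of b like 1 / alpha. *)
have h1 : b * (2 / 3) <= b - 4 / 3 * b ^+ 3.
  rewrite (_ : _ - _ = b * (1 - 4 / 3 * b ^+ 2)); last by ring.
  by rewrite ler_pM2l//; lra.
pose q := b / 2 - 2 * b ^+ 3 / 3.
have qE : b - 4 / 3 * b ^+ 3 = 2 * q by rewrite /q; field.
have q0 : 0 < q by move: h1; rewrite qE; lra.
exists (- D / q), b; split; first by rewrite (ltW b0) b1.
- by rewrite -/q divfK// gt_eqF.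
- right; move: hb; rewrite qE => hb.
  rewrite normrM normrN normfV (gtr0_norm q0).
  apply: (@mulIf _ (2 * q)); first by rewrite gt_eqF// mulr_gt0.
  by rewrite hb; field; rewrite gt_eqF.
- have : alpha * (b * (2 / 3)) <= `|D| * (2^-1 - b) ^+ 2 by rewrite -hb ler_pM2l.
  have : `|D| * (2^-1 - b) ^+ 2 <= `|D| * 4^-1 by rewrite ler_pM2l// expr2; nra.
  by lra.
Qed.

(** The limit of the optimal controls; assigning 1/2 to the right branch matches the convention in
    [asymptotic_control]. *)
Definition jump (R : realType) (A D t : R) : R := if t < 2^-1 then A + 2 * D else A - 2 * D.

Lemma dist_ctrl_jump (R : realType) (A D c b t : R) :
  0 <= b <= 2^-1 -> c * (b / 2 - 2 * b ^+ 3 / 3) = - D ->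
  0 <= t <= 1 -> b < `|t - 2^-1| ->
  `|jump R A D t - ctrl R A c b t| <= 2 * `|D| * b.
Proof.
move=> b01 hc t01 bt.
have b2 : b ^+ 2 <= 4^-1 by rewrite expr2; nra.
have b22 : 2 * b ^+ 2 <= b by rewrite expr2; nra.
have hcb : c * b * (2^-1 - 2 / 3 * b ^+ 2) = - D by rewrite -hc; field.
have cb : `|c * b| <= 3 * `|D|.
  rewrite -[D]opprK normrN -hcb (normrM (c * b)) (ger0_norm (x := _ - _)); last by lra.
  by have := normr_ge0 (c * b); nra.
(* Outside the clamping window the error is c b + 2 D up to sign. The steering equation makes it c b
   times 4 b^2 / 3, hence at most 4 |D| b^2, and b <= 1/2 absorbs one factor of b. *)
have key : `|c * b + 2 * D| <= 2 * `|D| * b.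
  have -> : c * b + 2 * D = (c * b) * (4 / 3 * b ^+ 2) by rewrite -[D]opprK -hcb; field.
  rewrite normrM (ger0_norm (x := _ * b ^+ 2)); last by rewrite mulr_ge0 ?sqr_ge0//; lra.
  have h1 : `|c * b| * (4 / 3 * b ^+ 2) <= 3 * `|D| * (4 / 3 * b ^+ 2).
    by rewrite ler_wpM2r// mulr_ge0 ?sqr_ge0//; lra.
  have h2 : `|D| * (2 * b ^+ 2) <= `|D| * b by rewrite ler_wpM2l.
  by lra.
rewrite /jump /ctrl; case: ltP => ht.
- move: bt; rewrite ltr0_norm; last by lra.
  move=> bt; rewrite !ramp_eq0; [|lra|lra].
  by rewrite (_ : _ - _ = c * b + 2 * D)//; ring.
- move: bt; rewrite ger0_norm; last by lra.
  move=> bt; rewrite !ramp_id; [|lra|lra].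
  by rewrite (_ : _ - _ = - (c * b + 2 * D)) ?normrN//; field.
Qed.

Lemma min_tv_family_cvg (R : realType) (s0 sf v0 vf : R) (ua : R -> R -> R) (t : R) :
  min_tv_family s0 sf v0 vf ua -> 0 <= t <= 1 -> t != 2^-1 ->
  ua alpha t @[alpha --> +oo] --> jump R (vf - v0) (2 * (sf - s0) - vf - v0) t.
Proof.
move=> mua t01 tn; set D := _ - _ - _.
have t0 : 0 < `|t - 2^-1| by rewrite normr_gt0 subr_eq0.
apply/cvgrPdist_le => e e0.
(* Since alpha b <= |D|, the second threshold puts [t] outside the clamping window and the third
   makes the error 2 |D| b at most [e]; the 1 keeps [alpha] positive. *)
exists (Num.max 1 (Num.max (`|D| / `|t - 2^-1|) (2 * `|D| * `|D| / e))).
split; first exact: num_real.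
move=> alpha; rewrite !gt_max ltr_pdivrMr// ltr_pdivrMr// => /andP[al1 /andP[al2 al3]].
have al0 : 0 < alpha by lra.
have [c [b [b01 hc ha ab]]] := ctrl_parameters R D alpha al0.
have [W st opt] := mua alpha al0.
have -> : ua alpha t = ctrl R (vf - v0) c b t.
  apply: (ctrl_unique R s0 sf v0 vf c b alpha _ b01 (ltW al0) hc ha) => //.
  - exact: W11_square_integrable.
  - exact: abs_continuous_within.
  - by apply: opt; [exact: W11_ctrl|exact: steers_ctrl].
have bt : b < `|t - 2^-1|.
  by rewrite -(ltr_pM2l al0); apply: le_lt_trans ab _.
apply: le_trans (dist_ctrl_jump R (vf - v0) D c b t b01 hc t01 bt) _.
rewrite -(ler_pM2l al0).
have : 2 * `|D| * (alpha * b) <= 2 * `|D| * `|D| by rewrite ler_wpM2l// mulr_ge0.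
by lra.
Qed.

Lemma min_tv_family_exists (R : realType) (s0 sf v0 vf : R) :
  exists ua, min_tv_family s0 sf v0 vf ua.
Proof.
suff /choice[ua H] : forall alpha : R, exists u, 0 < alpha -> min_tv_control s0 sf v0 vf alpha u.
  by exists ua.
(* Choice ranges over all real [alpha]; nonpositive values receive an arbitrary function. *)
move=> alpha; have [al0|al0] := ltP 0 alpha; last by exists id.
have [c [b [b01 hc ha _]]] := ctrl_parameters R (2 * (sf - s0) - vf - v0) alpha al0.
exists (ctrl R (vf - v0) c b) => _; split; [exact: W11_ctrl|exact: steers_ctrl|].
move=> v Wv stv; apply: (ctrl_minimal R s0 sf v0 vf) => //; first exact: ltW.
exact: W11_square_integrable.
Qed.

(** * Comparison of the two total variations *)

Lemma tv_cost0 (R : realType) (u : R -> R) : tv_cost 0 u = energy u.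
Proof. by rewrite /tv_cost mul0e adde0. Qed.

Lemma total_variation_jump (R : realType) (A D : R) (u : R -> R) :
  (forall t, 0 <= t <= 1 -> u t = jump R A D t) -> TV01 u = (4 * `|D|)%:E.
Proof.
(* The step goes down by 4 D, so the monotonicity sign is opposite to that of [D]. *)
move=> uE; pose s := if D < 0 then 1 else -1 : R.
rewrite /TV01 (monotone_total_variation R 0 1 _ s)//.
- rewrite !uE ?lexx ?ler01// /jump ifF; last by apply/negbTE; rewrite -leNgt; lra.
  rewrite ifT; last by lra.
  rewrite (_ : _ - _ = - (4 * D)); last by ring.
  by rewrite normrN normrM (ger0_norm (x := 4)).
- move=> x y x0 xy y1; rewrite (uE x) ?(uE y); [|lra|lra].
  rewrite /jump /s.
  by case: ltP => ?; case: ltP => ?; case: ltP => ?; lra.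
- by rewrite /s; case: ifP => _; rewrite ?oppr_eq0 oner_eq0.
Qed.

(** The two existence clauses ensure that the universally quantified comparison is not vacuous. *)
Theorem mainTheorem3 (R : realType) (s0 sf v0 vf : R) :
  (exists ue : R -> R, min_energy_control s0 sf v0 vf ue) /\
  (exists (ua : R -> R -> R) (uinf : R -> R),
      min_tv_family s0 sf v0 vf ua /\ asymptotic_control ua uinf) /\
  (forall (ue : R -> R) (ua : R -> R -> R) (uinf : R -> R),
      min_energy_control s0 sf v0 vf ue ->
      min_tv_family s0 sf v0 vf ua ->
      asymptotic_control ua uinf ->
      TV01 ue = (6 * `|2 * (sf - s0) - vf - v0|)%:E /\
      TV01 uinf = ((2 / 3)%:E * TV01 ue)%E).
Proof.
set D := 2 * (sf - s0) - vf - v0; set A := vf - v0.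
have b01 : 0 <= (2^-1 : R) <= 2^-1 by rewrite invr_ge0 lexx ler0n.
(* At b = 1/2 the factor b/2 - 2 b^3 / 3 equals 1/6, whence c = -6 D. *)
have hc : - 6 * D * (2^-1 / 2 - 2 * 2^-1 ^+ 3 / 3) = - D by field.
have ha : - 6 * D = 0 \/ 0 = `|- 6 * D| * ((2^-1 - 2^-1) ^+ 2 / 2).
  by right; rewrite subrr expr0n/= mul0r mulr0.
split; [|split].
- exists (ctrl R A (- 6 * D) 2^-1); split.
  + by apply: W11_square_integrable; exact: W11_ctrl.
  + exact: steers_ctrl.
  + by apply: abs_continuous_within; exact: W11_ctrl.
  (* Energy is the cost at [alpha = 0], even for a v of infinite variation, because 0 times infinity
     is 0 here. *)
  + move=> v sv stv; rewrite -!tv_cost0.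
    exact: (ctrl_minimal R s0 sf v0 vf).
- have [ua mua] := min_tv_family_exists R s0 sf v0 vf.
  exists ua, (jump R A D); split => //; split => [t t01 tn|t /andP[t2 t1]].
    exact: (min_tv_family_cvg R s0 sf v0 vf).
  by rewrite /jump ltxx ltNge (ltW t2).
move=> ue ua uinf [sue stue cue mue] mua [cvinf uinf1].
have -> : TV01 ue = (6 * `|D|)%:E.
  rewrite (total_variation_ctrl R A (- 6 * D) 2^-1)//.
    by congr EFin; rewrite mulNr normrN normrM (ger0_norm (x := 6))//; field.
  apply: (ctrl_unique R s0 sf v0 vf _ _ 0) => //.
  rewrite !tv_cost0; apply: mue; last exact: steers_ctrl.
  by apply: W11_square_integrable; exact: W11_ctrl.
split=> //; have uinfE t : 0 <= t <= 1 -> t != 2^-1 -> uinf t = jump R A D t.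
  move=> t01 tn; have cvj := min_tv_family_cvg R s0 sf v0 vf ua t mua t01 tn.
  exact: (cvg_unique (@Rhausdorff R) (cvinf t t01 tn) cvj).
rewrite (total_variation_jump R A D); first by rewrite -EFinM; congr EFin; field.
move=> t t01; have [->|tn] := eqVneq t 2^-1; last exact: uinfE.
(* The value at 1/2 is read off at t = 1, where the limit is known to be that of [jump]. *)
rewrite -(uinf1 1); last by lra.
rewrite uinfE; [|lra|by apply/eqP; lra].
by rewrite /jump ltxx ifF//; apply/negbTE; rewrite -leNgt; lra.
Qed.
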